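(* Each multicomplex $\Gamma\subset\mathbb{N}_\infty^n$ has a finite number of facets.
   Context: $\mathbb{N}=\{0,1,2,\dots\}$, $\mathbb{N}_\infty=\mathbb{N}\cup\{\infty\}$; $\mathbb{N}_\infty^n$ is ordered componentwise, with $c\le\infty$ for all $c$. A subset $\Gamma\subset\mathbb{N}_\infty^n$ is a multicomplex if (1) $a\in\Gamma$, $b\in\mathbb{N}_\infty^n$, $b\le a$ imply $b\in\Gamma$; and (2) $\Gamma$ contains the (componentwise) limit of every ascending sequence $a_1\le a_2\le\cdots$ of elements of $\Gamma$. For $a\in\mathbb{N}_\infty^n$ put $\operatorname{infpt}a=\{i:a(i)=\infty\}$. Let $\mathcal{M}(\Gamma)$ be the set of maximal elements of $\Gamma$. An element $a\in\Gamma$ is a facet of $\Gamma$ if $\operatorname{infpt}a=\operatorname{infpt}m$ for all $m\in\mathcal{M}(\Gamma)$ with $a\le m$. *)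

(* Defs.v *)
From HB Require Import structures.
From mathcomp Require Import all_boot all_order.
From mathcomp Require Import all_classical.
From mathcomp Require Import topology.

Set Implicit Arguments.
Unset Strict Implicit.
Unset Printing Implicit Defensive.

Import Order.TTheory.

Local Open Scope order_scope.
Local Open Scope classical_set_scope.

(* [Some k] is the natural number k and [None] is the point at infinity; the
   topology is the one in which sequences of [natinf] have their usual limits
   (see [cvg_natinf_fin] and [cvg_natinf_infty]). *)
Definition natinf : Type := one_point_compactification nat.
HB.instance Definition _ := Choice.on natinf.
HB.instance Definition _ := Pointed.on natinf.
HB.instance Definition _ := Topological.on natinf.

Definition infty : natinf := None.

Definition le_natinf (x y : natinf) : bool :=
  match x, y with
  | _, None => true
  | None, Some _ => false
  | Some j, Some k => (j <= k)%N
  end.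

Fact natinf_display : Order.disp_t. Proof. exact: Order.default_display. Qed.

Fact le_natinf_refl : reflexive le_natinf.
Proof. by case=> //= k; exact: leqnn. Qed.

Fact le_natinf_anti : antisymmetric le_natinf.
Proof. by move=> [j|] [k|] //= /anti_leq ->. Qed.

Fact le_natinf_trans : transitive le_natinf.
Proof. by move=> [j|] [i|] [k|] //=; exact: leq_trans. Qed.

Fact le_natinf_total : total le_natinf.
Proof. by move=> [j|] [k|] //=; exact: leq_total. Qed.

HB.instance Definition _ := Order.Le_isPOrder.Build natinf_display natinf
  le_natinf_refl le_natinf_anti le_natinf_trans.

HB.instance Definition _ :=
  Order.POrder_isTotal.Build natinf_display natinf le_natinf_total.

Fact le_natinf_top (x : natinf) : x <= infty.
Proof. by case: x. Qed.

HB.instance Definition _ :=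
  Order.hasTop.Build natinf_display natinf le_natinf_top.

Lemma cvg_natinf_fin (u : nat -> natinf) (k : nat) :
  u @ \oo --> (Some k : natinf) <-> \forall m \near \oo, u m = Some k.
Proof.
split=> [uk|uk].
  apply: (uk [set Some k : natinf]).
  rewrite -image_set1.
  exact/one_point_compactification_some_nbhs/discrete_set1.
move=> A /nbhs_singleton Ak; apply: filterS uk => m /= umk.
by rewrite /= umk.
Qed.

Lemma cvg_natinf_infty (u : nat -> natinf) :
  u @ \oo --> infty <-> forall k, \forall m \near \oo, (Some k : natinf) <= u m.
Proof.
split=> [uoo k|uoo A [C [cptC _] CA]].
  apply: (uoo [set x | (Some k : natinf) <= x]).
  exists `I_k.
    by split; [exact/finite_compact/finite_II|exact: discrete_closed].
  move=> _ [[j /= jk <-]|->//].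
  by rewrite /Order.le/= leqNgt; apply/negP.
have /compact_near_coveringP/(_ nat \oo (fun k j => (j < k)%N) _) CI := cptC.
have [|k _ kC] := CI.
  move=> j _; exists ([set j], [set k | (j < k)%N]).
    by split=> /=; [exact: discrete_set1|exists j.+1].
  by case=> i k [/= ->].
apply: filterS (uoo k) => m km; apply: CA => /=.
case: (u m) km => [j kj|]; [left|by right].
exists j => // /(kC k (leqnn k)); rewrite ltnNge => /negP; exact.
Qed.

(* The order on ['I_n -> natinf] is the pointwise one, provided by
   [boolp.FunOrder]. *)
Definition multicomplex (n : nat) (Gamma : set ('I_n -> natinf)) : Prop :=
  (forall a b : 'I_n -> natinf, Gamma a -> b <= a -> Gamma b) /\
  (forall (a_ : nat -> 'I_n -> natinf) (l : 'I_n -> natinf),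
     (forall k, Gamma (a_ k)) ->
     (forall k, a_ k <= a_ k.+1) ->
     (forall i, (fun k => a_ k i) @ \oo --> l i) ->
     Gamma l).

Definition infpt (n : nat) (a : 'I_n -> natinf) : set 'I_n :=
  [set i | a i = infty].

Definition maximal_elements (n : nat) (Gamma : set ('I_n -> natinf)) :
    set ('I_n -> natinf) :=
  [set m | Gamma m /\ forall b, Gamma b -> m <= b -> b = m].

Definition facets (n : nat) (Gamma : set ('I_n -> natinf)) :
    set ('I_n -> natinf) :=
  [set a | Gamma a /\
     forall m, maximal_elements Gamma m -> a <= m -> infpt a = infpt m].

(* Main.v *)
Require Import Defs.
From mathcomp Require Import all_boot all_order.
From mathcomp Require Import all_classical.
From mathcomp Require Import topology.

(* By Dickson's lemma, an infinite set of facets would contain a strictly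
    ascending sequence.  Its limit [l] lies in [Gamma] and has an infinite
    coordinate which is finite along the sequence.  But [l] is below some
    maximal element [m], and since the terms of the sequence are facets they
    have the same infinite coordinates as [m], a contradiction.  Maximal
    elements exist above any element because a failure again produces a strictly
    ascending sequence, whose limit has more infinite coordinates. *)

Set Implicit Arguments.
Unset Strict Implicit.
Unset Printing Implicit Defensive.

Import Order.TTheory.

Local Open Scope order_scope.
Local Open Scope classical_set_scope.

(** An unbounded sequence tends to [infty]; one with a finite bound attains its largest value and
    stays there. *)
Lemma nondecreasing_natinf_cvg (u : nat -> natinf) :
  (forall k, u k <= u k.+1) ->
  exists l : natinf, u @ \oo --> l /\ forall k, u k <= l.
Proof.
move=> u_nd; have u_le : {homo u : i j / (i <= j)%N >-> i <= j}.
  exact: homo_leq le_refl le_trans u_nd.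
have [unb|/existsNP[b /forallNP bP]] :=
    pselect (forall k, exists m, (Some k : natinf) <= u m).
  exists infty; split; last by move=> k; exact: le_natinf_top.
  apply/cvg_natinf_infty => k; have [m km] := unb k.
  by exists m => // j /= mj; exact: le_trans km (u_le _ _ mj).
have ub m : exists2 j, u m = Some j & (j <= b)%N.
  have := bP m; case: (u m) => [j /negP|[]//].
  by rewrite /Order.le/= -ltnNge => /ltnW jb; exists j.
pose P j := `[< exists m, u m = Some j >].
have exP : exists j, P j.
  by have [j uj _] := ub 0%N; exists j; apply/asboolP; exists 0%N.
have P_le j : P j -> (j <= b)%N.
  by move=> /asboolP[m um]; have [j' + j'b] := ub m; rewrite um => -[->].
have [j /asboolP[m um] jmax] := ex_maxnP exP P_le.
have ujmax k : u k <= (Some j : natinf).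
  have [i ui _] := ub k; rewrite ui /Order.le/=.
  by apply: jmax; apply/asboolP; exists k.
exists (Some j); split => //; apply/cvg_natinf_fin.
exists m => // k /= mk; apply/le_anti; rewrite ujmax/=.
by rewrite -um; exact: u_le.
Qed.

(** The least finite value on the tail is attained; a tail without finite values is constantly
    [infty]. *)
Lemma natinf_tail_min (u : nat -> natinf) (N : nat) :
  exists2 m, (N <= m)%N & forall j, (N <= j)%N -> u m <= u j.
Proof.
pose P k := `[< exists2 m, (N <= m)%N & u m = Some k >].
have [exP|/forallNP noP] := pselect (exists k, P k).
  have [k /asboolP[m Nm um] kmin] := ex_minnP exP.
  exists m => // j Nj; rewrite um.
  case uj: (u j) => [i|//]; rewrite /Order.le/=.
  by apply: kmin; apply/asboolP; exists j.
exists N => // j Nj; case uj: (u j) => [i|]; last exact: le_natinf_top.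
by case: (noP i); apply/asboolP; exists j.
Qed.

Lemma natinf_nondecreasing_subseq (u : nat -> natinf) :
  exists2 phi : nat -> nat, (forall k, (phi k < phi k.+1)%N) &
    forall k, u (phi k) <= u (phi k.+1).
Proof.
have /choice[g gP] : forall N, exists m,
    (N <= m)%N /\ forall j, (N <= j)%N -> u m <= u j.
  by move=> N; have [m] := natinf_tail_min u N; exists m.
(* Each index minimises [u] past the previous index, so the values can only grow. *)
pose phi := fix phi k := if k is k'.+1 then g (phi k').+1 else g 0%N.
have phi_lt k : (phi k < phi k.+1)%N by have [] := gP (phi k).+1.
exists phi => // -[|k].
  by have [_] := gP 0%N; apply.
by have [_] := gP (phi k).+1; apply; exact: leq_trans (phi_lt k) (ltnW _).
Qed.

Lemma dickson_natinf (n : nat) (f : nat -> 'I_n -> natinf) :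
  exists2 phi : nat -> nat, (forall k, (phi k < phi k.+1)%N) &
    forall k, f (phi k) <= f (phi k.+1).
Proof.
suff [phi phi_lt phi_le] : exists2 phi : nat -> nat,
    (forall k, (phi k < phi k.+1)%N) &
    forall i, i \in enum 'I_n -> forall k, f (phi k) i <= f (phi k.+1) i.
  exists phi => // k; apply/lefP => i; exact: phi_le (mem_enum _ i) k.
(* Coordinates are treated one at a time: a further subsequence stays nondecreasing in those already
   treated. *)
elim: (enum 'I_n) => [|i s [phi phi_lt phi_le]]; first by exists id.
have [psi psi_lt psi_le] :=
  natinf_nondecreasing_subseq (fun k => f (phi k) i).
exists (phi \o psi) => [k|j].
  exact: (homo_ltn ltn_trans phi_lt).
rewrite inE => /predU1P[->//|js k] /=.
have := @homo_leq _ (fun k => f (phi k) j) _ le_refl le_trans (phi_le _ js).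
by apply; exact: ltnW.
Qed.

Lemma infpt_le (n : nat) (a b : 'I_n -> natinf) : a <= b -> infpt a `<=` infpt b.
Proof.
by move=> /lefP ab i ai; apply/le_anti; rewrite le_natinf_top -ai/= ab.
Qed.

Section Multicomplex.
Context (n : nat) (Gamma : set ('I_n -> natinf)).
Context (multicomplexGamma : multicomplex Gamma).

Lemma ascending_limit (c : nat -> 'I_n -> natinf) :
  (forall k, Gamma (c k)) -> (forall k, c k < c k.+1) ->
  exists l, [/\ Gamma l, forall k, c k <= l & infpt l <> infpt (c 0%N)].
Proof.
move=> Gc c_lt; have c_le k : c k <= c k.+1 by exact/ltW.
have /choice[l lP] : forall i, exists x : natinf,
    (fun k => c k i) @ \oo --> x /\ forall k, c k i <= x.
  by move=> i; apply: nondecreasing_natinf_cvg => k; exact/lefP/c_le.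
have cl k : c k <= l by apply/lefP => i; have [_] := lP i; exact.
exists l; split=> //.
  by apply: (multicomplexGamma.2 c) => // i; have [] := lP i.
(* If [l] had no new infinite coordinate, the sum of the finite coordinates
   would increase strictly along [c] while being bounded by that of [l]. *)
move=> infl; pose fin (x : natinf) := if x is Some k then k else 0%N.
pose w (a : 'I_n -> natinf) := (\sum_i fin (a i))%N.
have c0_le k : c 0%N <= c k by elim: k => // k; move/le_trans; apply.
(* [c k] lies between [c 0] and [l], which have the same infinite coordinates. *)
have infc k i : c k i = infty <-> l i = infty.
  split; first exact: (infpt_le (cl k)).
  have -> : (l i = infty) = infpt l i by [].
  by rewrite infl; exact: infpt_le.
(* As [fin] sends [infty] to 0, monotonicity fails when only [y] is infinite. *)
have fin_le x y : x <= y -> (y = infty -> x = infty) -> (fin x <= fin y)%N.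
  case: x y => [x|] [y|] //=; by move=> _ /(_ erefl).
have w_lt k : (w (c k) < w (c k.+1))%N.
  have fin_c i : (fin (c k i) <= fin (c k.+1 i))%N.
    by apply: fin_le; [exact/lefP/c_le | move/infc/infc].
  rewrite ltn_neqAle leq_sum ?andbT//; apply/negP => /eqP wE.
  (* Equal sums of termwise ordered families agree termwise, which would give [c k = c k.+1]. *)
  have /eqP := wE; rewrite /w.
  rewrite (leqif_sum (fun i _ => leqif_eq (fin_c i))).2 => /forall_inP finE.
  have := c_lt k; rewrite lt_neqAle => /andP[/eqP+ _]; apply.
  apply/funext => i; have /eqP := finE i isT.
  case ck: (c k i) => [x|]; case ck1: (c k.+1 i) => [y|] //=; first by move=> ->.
    by move: ck1 => /infc/(infc k); rewrite ck.
  by move: ck => /infc/(infc k.+1); rewrite ck1.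
have w_ge k : (k <= w (c k))%N.
  by elim: k => // k /leq_ltn_trans; apply.
have := w_ge (w l).+1; rewrite ltnNge => /negP; apply.
apply: leq_sum => i _; apply: fin_le; first exact/lefP/cl.
by move/infc.
Qed.

Lemma exists_maximal (a : 'I_n -> natinf) : Gamma a ->
  exists2 m, maximal_elements Gamma m & a <= m.
Proof.
(* Induction on the number of finite coordinates, which drops from [a] to the limit of a strict
   ascent from [a]. *)
have [N] := ubnP #|[set i | a i != infty]%SET|.
elim: N a => // N IH a; rewrite ltnS => aN Ga; apply: contrapT => noMax.
(* With no maximal element above [a], every element of [Gamma] above [a] can be strictly increased;
   elsewhere [next] is arbitrary. *)
have /choice[next nextP] : forall b, exists c,
    Gamma b -> a <= b -> Gamma c /\ b < c.
  move=> b; have [[Gb ab]|nb] := pselect (Gamma b /\ a <= b); last first.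
    by exists b => Gb ab; case: nb.
  apply: contrapT => /forallNP noc; apply: noMax; exists b => //.
  split=> // c Gc bc; apply/eqP; apply: contrapT => /negP cb.
  by apply: (noc c) => _ _; rewrite lt_neqAle eq_sym cb.
pose c k := iter k next a.
have cP k : Gamma (c k) /\ a <= c k.
  elim: k => //= k [Gc ac]; have [Gc' cc'] := nextP _ Gc ac.
  by split=> //; exact: le_trans ac (ltW cc').
have c_lt k : c k < c k.+1 by have [Gc ac] := cP k; have [] := nextP _ Gc ac.
have [l [Gl cl infl]] := ascending_limit (fun k => (cP k).1) c_lt.
have al : a <= l := cl 0%N.
have [|//|m mm lm] := IH l; last first.
  by apply: noMax; exists m => //; exact: le_trans lm.
apply: leq_trans aN; apply: proper_card; apply/fintype.properP; split.
  apply/fintype.subsetP => i; rewrite !inE; apply: contra => /eqP ai.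
  exact/eqP/(infpt_le al).
apply: contrapT => noi; apply: infl; apply/seteqP; split; last exact: infpt_le.
move=> i li /=; apply: contrapT => /eqP ai.
by apply: noi; exists i; rewrite !inE// negbK; exact/eqP.
Qed.

End Multicomplex.

Theorem lemma9p6 (n : nat) (Gamma : set ('I_n -> natinf))
  (multicomplexGamma : multicomplex Gamma) : finite_set (facets Gamma).
Proof.
apply: contrapT => /infiniteP/pcard_leP/injfunPex[f fF finj].
have [phi phi_lt phi_le] := dickson_natinf f.
have facet k : facets Gamma (f (phi k)) by exact: fF.
have f_lt k : f (phi k) < f (phi k.+1).
  rewrite lt_neqAle phi_le andbT; apply/eqP => /finj fE.
  by have := phi_lt k; rewrite -fE ?inE// ltnn.
have [l [Gl fl]] :=
  ascending_limit multicomplexGamma (fun k => (facet k).1) f_lt.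
have [m mm lm] := exists_maximal multicomplexGamma Gl; apply.
(* The first facet of the sequence suffices: its infinite coordinates are those of [m], hence
   include those of [l]. *)
apply/seteqP; split; last exact: infpt_le.
rewrite ((facet 0%N).2 m mm (le_trans (fl 0%N) lm)); exact: infpt_le.
Qed.
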